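(* Let $n\ge 1$. The radius of the Hurwitz graph $G_T(n)$ is $$\mathrm{rad}(G_T(n))=\binom{n-1}{2}.$$
   Context: $S_n$ is the symmetric group on $\{1,\dots,n\}$, with product $(\pi\sigma)(i)=\pi(\sigma(i))$; $T$ is the set of all transpositions in $S_n$. Let $c=(1,2,\dots,n)$ be the $n$-cycle. $NC(n)=\{\pi\in S_n:\ \ell_T(\pi)+\ell_T(\pi^{-1}c)=\ell_T(c)\}$, where $\ell_T(\pi)$ is the minimal number of factors in an expression of $\pi$ as a product of transpositions, ordered by $\pi\le\sigma\iff \ell_T(\pi)+\ell_T(\pi^{-1}\sigma)=\ell_T(\sigma)$. $F_n$ is the set of maximal chains of $NC(n)$; it is identified with the set of words $(t_1,\dots,t_{n-1})$ of transpositions with $t_1t_2\cdots t_{n-1}=c$, the word corresponding to the chain $id<t_1<t_1t_2<\cdots<c$ (for $n=1$, $F_1$ consists of the empty word). The Hurwitz graph $G_T(n)$ is the undirected graph with vertex set $F_n$, where two chains are adjacent if they differ in exactly one element. Equivalently, two distinct words are adjacent iff one is obtained from the other by replacing, for some $1\le i\le n-2$, the consecutive letters $(t_i,t_{i+1})$ by either $(t_{i+1}^{t_i},t_i)$ or $(t_{i+1},t_i^{t_{i+1}})$, where $g^h=h^{-1}gh$. This graph is connected. For a finite connected graph $G=(V,E)$ with graph metric $d$, $\mathrm{rad}(G)=\min_{v\in V}\max_{w\in V}d(v,w)$. *)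

(* Defs.v *)
From mathcomp Require Import all_boot all_fingroup.

Set Implicit Arguments.
Unset Strict Implicit.
Unset Printing Implicit Defensive.

Section Graph.

Variables (V : finType) (adj : rel V).

Definition has_walk (u v : V) (k : nat) : bool :=
  [exists p : k.-tuple V, path adj u p && (last u p == v)].

(* A shortest walk has fewer than #|V| edges, so the search is exhaustive.     *)
(* [find] returns #|V| when v is not reachable from u; this value exceeds      *)
(* every genuine distance and plays the role of an infinite distance.          *)
Definition gdist (u v : V) : nat := find (has_walk u v) (iota 0 #|V|).

(* The neutral element #|V| of the minimum is never attained by a maximum of   *)
(* genuine distances.                                                          *)
Definition radius : nat := \big[minn/#|V|]_(v : V) \max_(w : V) gdist v w.

End Graph.

Section NoncrossingPartitions.

Variable n : nat.
Implicit Types (s t : 'S_n) (C D : {set 'S_n}).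

(* Permutations are composed from right to left, (s t)(i) = s (t i), whereas   *)
(* the group law of 'S_n composes them from left to right.                     *)
Definition pmul s t : 'S_n := (t * s)%g.

Lemma pmulE s t i : pmul s t i = s (t i).
Proof. by rewrite /pmul permM. Qed.

Definition transpositions : {set 'S_n} :=
  [set t | [exists x : 'I_n, [exists y : 'I_n, (x != y) && (t == tperm x y)]]].

Definition has_factorization s (k : nat) : bool :=
  [exists w : k.-tuple 'S_n,
     all (mem transpositions) w && (foldr pmul 1%g w == s)].

Lemma ex_factorization s : exists k, has_factorization s k.
Proof.
have [ts -> dts] := prod_tpermP s.
pose w := rev [seq tperm p.1 p.2 | p <- ts].
exists (size w); apply/existsP; exists (in_tuple w); apply/andP; split => /=.
  rewrite all_rev all_map; apply/allP => -[x y] /(allP dts) /= xy.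
  by rewrite inE; apply/existsP; exists x; apply/existsP; exists y; rewrite xy /=.
rewrite {}/w; elim: ts {dts} => [|p ts IH]; first by rewrite big_nil.
rewrite big_cons /= rev_cons -cats1 foldr_cat /= /pmul mul1g.
move/eqP: IH => <-; elim: (rev _) => [|t w IHw] /=; first by rewrite mulg1.
by rewrite (eqP IHw) mulgA.
Qed.

Definition tlen s : nat := ex_minn (ex_factorization s).

Definition abs_le s t : bool := tlen s + tlen (pmul s^-1 t) == tlen t.

(* i |-> i + 1 mod n on the points 0, ..., n - 1, that is, (1,2,...,n).        *)
Definition long_cycle : 'S_n := perm (@ordS_inj n).

Definition NC : {set 'S_n} :=
  [set s | tlen s + tlen (pmul s^-1 long_cycle) == tlen long_cycle].

Definition NC_chain C : bool :=
  (C \subset NC)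
    && [forall s in C, forall t in C, abs_le s t || abs_le t s].

Definition NC_maxchain := {C : {set 'S_n} | maxset NC_chain C}.

Definition hurwitz_adj (u v : NC_maxchain) : bool :=
  (#|val u :\: val v| == 1) && (#|val v :\: val u| == 1).

End NoncrossingPartitions.

(* Main.v *)
Require Import Defs.
From mathcomp Require Import all_boot all_fingroup.
From mathcomp Require Import all_algebra zify.

(** A maximal chain of noncrossing partitions is the set of partial products of
a word [t_1, ..., t_m] of transpositions with product the long cycle [c], where
[m = n - 1].  The radius is computed by two independent arguments.

Upper bound.  Fix a point [x] moved by the product [g] of a word.  The letter
[tperm x (g x)] can be brought to the front of the word by at most [m - 1]
Hurwitz moves ([hurwitz_walk_to_front]): by induction the tail, with product
[g'], can be made to start with [tperm x (g' x)], and one more move exchanges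
the first letter with it, replacing [g' x] by [g x].  The tail is now a reduced
word of a permutation that depends only on [g] and [x], so the procedure can be
repeated, and all reduced words of [g] meet in one word after at most
[(m - 1) + (m - 2) + ... + 0] moves ([hurwitz_walk_common_end]).  For [g = c]
this word is a center of the graph.

Lower bound.  Send [s] to the row space [V(s)] of its permutation matrix minus
the identity, spanned by the vectors [e_(s i) - e_i].  On noncrossing
partitions the dimension of [V(s)] is the length of [s], and [V] is monotone, so
that maximal chains become complete flags.  A reference chain
[x_0 < ... < x_m] defines the jumps of [s], the indices [i] for which
[V(x_(i+1))] is not contained in [V(x_i) + V(s)].  The set of jumps has
[m - tlen s] elements and decreases with [s], so climbing a maximal chain
removes the jumps in some order; this is the relative position, a permutation,
of the two flags.  Adjacent chains have orders that agree up to swapping two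
consecutive removals, so the number of inversions changes by at most one along
an edge ([inversions_lipschitz]).  The reference chain has no inversions, and
its Kreweras complement [{s^-1 c}] has all of them, since [V(x_i)] and
[V(x_i^-1 c)] span [V(c)].  Hence every chain is at distance at least
['C(m, 2)] from its Kreweras complement. *)

Set Implicit Arguments.
Unset Strict Implicit.
Unset Printing Implicit Defensive.

Import GroupScope.

Local Notation is_word w := (all (mem (transpositions _)) w).
Local Notation prodw := (foldr (@pmul _) 1).

(** * Reflection length *)

Section Length.
Variable n : nat.
Implicit Types (s t u : 'S_n) (w : seq 'S_n).

Lemma transpositionP t :
  reflect (exists x y, x != y /\ t = tperm x y) (t \in transpositions n).
Proof.
rewrite inE; apply: (iffP existsP) => [[x /existsP[y /andP[xy /eqP ->]]]|].
  by exists x, y.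
by case=> x [y [xy ->]]; exists x; apply/existsP; exists y; rewrite xy eqxx.
Qed.

Lemma transpositionJ t s : t \in transpositions n -> t ^ s \in transpositions n.
Proof.
move=> /transpositionP[x [y [xy ->]]]; apply/transpositionP.
by exists (s x), (s y); rewrite tpermJ (inj_eq perm_inj).
Qed.

Lemma transpositionK t : t \in transpositions n -> t * t = 1.
Proof. by move=> /transpositionP[x [y [_ ->]]]; rewrite tperm2. Qed.

Lemma transpositionE t x :
  t \in transpositions n -> t x != x -> t = tperm x (t x).
Proof.
move=> /transpositionP[a [b [_ ->]]].
by case: tpermP => [->|->|_ _]; rewrite ?eqxx // tpermC.
Qed.

(** Words multiply by [pmul], from right to left, against the group law. *)
Lemma prodw_cat w1 w2 : prodw (w1 ++ w2) = prodw w2 * prodw w1.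
Proof.
by elim: w1 => [|t w1 IH] /=; rewrite ?mulg1 // /pmul IH mulgA.
Qed.

Lemma tlen_word s : exists w, [/\ is_word w, prodw w = s & size w = tlen s].
Proof.
rewrite /tlen; case: ex_minnP => k /existsP[w /andP[ww /eqP pw]] _.
by exists w; rewrite ww pw size_tuple.
Qed.

Lemma tlen_min w : is_word w -> tlen (prodw w) <= size w.
Proof.
move=> ww; rewrite /tlen; case: ex_minnP => k _; apply; apply/existsP.
by exists (in_tuple w); rewrite ww eqxx.
Qed.

Lemma tlen1 : tlen (1 : 'S_n) = 0.
Proof. by apply/eqP; rewrite -leqn0; apply: (@tlen_min [::]). Qed.

Lemma tlen_eq0 s : (tlen s == 0) = (s == 1).
Proof.
apply/eqP/eqP => [s0|->]; last exact: tlen1.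
by have [w [_ ps]] := tlen_word s; rewrite s0 -ps => /size0nil ->.
Qed.

Lemma tlenM s t : tlen (s * t) <= tlen s + tlen t.
Proof.
have [w [ww <- <-]] := tlen_word s; have [v [wv <- <-]] := tlen_word t.
by rewrite addnC -prodw_cat -size_cat tlen_min // all_cat wv ww.
Qed.

Lemma tlen_transposition t : t \in transpositions n -> tlen t <= 1.
Proof.
by move=> tT; have := @tlen_min [:: t]; rewrite /= tT /pmul mul1g; apply.
Qed.

(** Conjugation permutes the transpositions. *)
Lemma tlenJ s u : tlen (s ^ u) = tlen s.
Proof.
suff le_conj s' v : tlen (s' ^ v) <= tlen s'.
  by apply/eqP; rewrite eqn_leq le_conj -{1}(conjgK u s) le_conj.
have [w [ww <- <-]] := tlen_word s'; rewrite -(size_map (conjg^~ v)).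
suff -> : prodw w ^ v = prodw (map (conjg^~ v) w).
  apply: tlen_min; rewrite all_map; apply: sub_all ww => t /=.
  exact: transpositionJ.
by elim: w {ww} => [|t w IH] /=; rewrite ?conj1g // /pmul conjMg IH.
Qed.

(** Multiplying [s] by the transposition of [x] and [s x] fixes [x] and keeps every
fixed point of [s], so each letter of a word for [s] can be made to account for
one moved point; the last letter accounts for two. *)
Lemma tlen_support s : tlen s <= #|[set x | s x != x]|.-1.
Proof.
have [k] := ubnP #|[set x | s x != x]|; elim: k s => // k IH s ltk.
have [->|s1] := eqVneq s 1; first by rewrite tlen1.
have [x sx] : exists x, s x != x.
  apply/existsP; apply: contraNT s1 => /existsPn fixs.
  by apply/eqP/permP => x; rewrite perm1; apply/eqP/negPn/fixs.
set t := tperm x (s x); pose r := s * t.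
have tT : t \in transpositions n by apply/transpositionP; exists x, (s x); rewrite eq_sym.
have sE : s = r * t by rewrite /r -mulgA tperm2 mulg1.
have rx : r x = x by rewrite permM tpermR.
have sub : [set y | r y != y] \subset [set y | s y != y] :\ x.
  apply/subsetP => y; rewrite !inE; have [->|yx] /= := eqVneq y x.
    by rewrite rx eqxx.
  apply: contraNneq => sy; rewrite permM sy tpermD //; first by rewrite eq_sym.
  by apply: contraNneq yx => sxy; rewrite -(inj_eq (@perm_inj _ s)) sy sxy.
have xin : x \in [set y | s y != y] by rewrite inE.
have le1 := subset_leq_card sub.
rewrite (cardsD1 x [set y | s y != y]) xin add1n /= in ltk *.
have [r1|r1] := eqVneq r 1.
  rewrite {1}sE r1 mul1g; apply: leq_trans (tlen_transposition tT) _.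
  by rewrite card_gt0; apply/set0Pn; exists (s x); rewrite !inE sx (inj_eq perm_inj).
have rpos : 0 < #|[set y | r y != y]|.
  rewrite card_gt0; apply: contraNneq r1 => r0; apply/eqP/permP => y.
  by rewrite perm1; apply/eqP; have := in_set0 y; rewrite -r0 inE => /negbFE.
rewrite {1}sE; apply: leq_trans (tlenM _ _) _.
apply: leq_trans (leq_add (IH r (leq_ltn_trans le1 _)) (tlen_transposition tT)) _ => //.
by rewrite addn1 prednK.
Qed.
End Length.

(** * Hurwitz moves on words *)

Section Walks.
Variable n : nat.
Implicit Types (s t u : 'S_n) (w p q : seq 'S_n).

(** The index bounds the number of moves from above.  A move may rewrite two
consecutive letters by any two transpositions with the same product: this
changes the chain of partial products in at most one element, which is the
adjacency of chains; it contains the Hurwitz moves, and the trivial one. *)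
Inductive hurwitz_walk : nat -> seq 'S_n -> seq 'S_n -> Prop :=
| hurwitz_walk_refl k w : hurwitz_walk k w w
| hurwitz_walk_step k p q a b a' b' w :
    is_word [:: a'; b'] -> pmul a b = pmul a' b' ->
    hurwitz_walk k (p ++ [:: a', b' & q]) w -> hurwitz_walk k.+1 (p ++ [:: a, b & q]) w.

Lemma hurwitz_walk_cons k t w w' : hurwitz_walk k w w' -> hurwitz_walk k (t :: w) (t :: w').
Proof.
elim=> [|{}k p q a b a' b' {}w ww ab _ IH]; first by constructor.
exact: (@hurwitz_walk_step k (t :: p)) ab IH.
Qed.

Lemma hurwitz_walkW k l w w' : k <= l -> hurwitz_walk k w w' -> hurwitz_walk l w w'.
Proof.
move=> + walk; elim: walk l => [{}k v l _|{}k p q a b a' b' {}w ww ab _ IH [|l] // kl].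
  by constructor.
exact: hurwitz_walk_step ww ab (IH l kl).
Qed.

Lemma hurwitz_walk_trans k l w1 w2 w3 :
  hurwitz_walk k w1 w2 -> hurwitz_walk l w2 w3 -> hurwitz_walk (k + l) w1 w3.
Proof.
elim=> [{}k w|{}k p q a b a' b' {}w2 ww ab _ IH] walk.
  exact: hurwitz_walkW (leq_addl _ _) walk.
exact: hurwitz_walk_step ww ab (IH walk).
Qed.

Lemma hurwitz_walk_invariant k w w' : hurwitz_walk k w w' ->
  [/\ is_word w -> is_word w', prodw w = prodw w' & size w = size w'].
Proof.
elim=> [|{}k p q a b a' b' {}w ww ab _ [IHw <- <-]] //; split.
- rewrite !all_cat /= in IHw * => /and4P[wp _ _ wq]; apply: IHw.
  by move: ww => /= /and3P[-> -> _]; rewrite wp.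
- by rewrite !prodw_cat /= -[pmul a _]mulgA -[pmul a' _]mulgA; congr (_ * _ * _).
- by rewrite !size_cat.
Qed.

(** The tail, with product [u], is first made to start with [tperm x y] where
[y = u x]; the head [t] satisfies [t y != x].  If [t] fixes [x], conjugating
[tperm x y] by [t] gives [tperm x (t y)]; otherwise [t] is [tperm x (t x)] with
[t x] different from [x] and [y], so [t y = y] and conjugating [t] by
[tperm x y] leaves [tperm x y] in front. *)
Lemma hurwitz_walk_to_front x w : is_word w -> prodw w x != x ->
  exists w', hurwitz_walk (size w).-1 w (tperm x (prodw w x) :: w').
Proof.
elim: w => [|t w IH] /=; first by rewrite perm1 eqxx.
move=> /andP[tT ww]; rewrite pmulE; set y := prodw w x => tyx.
have [yx|yx] := eqVneq y x.
  exists w; rewrite yx in tyx *; rewrite -transpositionE //.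
  exact: hurwitz_walk_refl.
have [w' walk] := IH ww yx.
have size_w : size w = (size w).-1 + 1.
  rewrite addn1 prednK // lt0n size_eq0.
  by apply: contraNneq yx => w0; rewrite /y w0 perm1.
pose r := tperm x (t y).
have rT : r \in transpositions n.
  by apply/transpositionP; exists x, (t y); rewrite eq_sym.
(* The new second letter, in the two cases of the exchange. *)
pose b := if t x == x then t else t ^ tperm x y.
exists (b :: w'); rewrite size_w.
apply: hurwitz_walk_trans (hurwitz_walk_cons _ walk)
  (hurwitz_walk_step (p := [::]) _ _ (hurwitz_walk_refl _ _)).
  by rewrite /= rT /b; case: ifP; rewrite ?transpositionJ ?tT.
rewrite -/r /pmul /b; case: eqP => [tx|/eqP tx].
  have -> : r = tperm x y ^ t by rewrite tpermJ tx.
  by rewrite -conjgC.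
have ty : t y = y.
  move: tyx; rewrite (transpositionE tT tx).
  by case: tpermP => [/eqP|_|]; rewrite ?(negPf yx) ?eqxx.
by rewrite /r ty conjgE tpermV -!mulgA tperm2 mulg1.
Qed.

(** Moving the letter [tperm x (u x)] to the front of a word of length [m + 1] costs
[m] moves and leaves a word for a permutation that does not depend on the given
word. *)
Lemma hurwitz_walk_common_end u m : tlen u = m ->
  exists w0, forall w, is_word w -> prodw w = u -> size w = m ->
    hurwitz_walk 'C(m, 2) w w0.
Proof.
elim: m u => [|m IH] u um.
  by exists [::] => w _ _ /size0nil ->; constructor.
have [x ux] : exists x, u x != x.
  apply/existsP; apply: contra_eqT um => /existsPn fixu.
  suff -> : u = 1 by rewrite tlen1.
  by apply/permP => x; rewrite perm1; apply/eqP/negPn/fixu.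
pose t := tperm x (u x); pose u' := u * t.
have tT : t \in transpositions n.
  by apply/transpositionP; exists x, (u x); rewrite eq_sym.
have front w : is_word w -> prodw w = u -> size w = m.+1 ->
    exists w', [/\ hurwitz_walk m w (t :: w'), is_word w', prodw w' = u' & size w' = m].
  move=> ww pw sw; have uw : prodw w x != x by rewrite pw.
  have [w' walk] := hurwitz_walk_to_front ww uw; rewrite sw pw -/t in walk.
  have [/(_ ww)/andP[_ ww'] pw' [sw']] := hurwitz_walk_invariant walk.
  exists w'; split=> //; last by rewrite sw in sw'; case: sw'.
  by rewrite /u' -pw pw' /= /pmul -mulgA transpositionK ?mulg1.
have u'm : tlen u' = m.
  have [w [ww pw sw]] := tlen_word u; rewrite um in sw.
  have [w' [_ ww' pw' sw']] := front w ww pw sw.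
  apply/eqP; rewrite eqn_leq -{1}pw' -{1}sw' tlen_min //= -ltnS -um.
  have -> : u = u' * t by rewrite /u' -mulgA transpositionK ?mulg1.
  by rewrite -addn1 (leq_trans (tlenM _ _)) // leq_add2l tlen_transposition.
have [w0 near] := IH _ u'm.
exists (t :: w0) => w ww pw sw.
have [w' [walk ww' pw' sw']] := front w ww pw sw.
rewrite binS bin1 addnC.
exact: hurwitz_walk_trans walk (hurwitz_walk_cons _ (near _ ww' pw' sw')).
Qed.
End Walks.

(** * The absolute order and chains of partial products *)

Section AbsoluteOrder.
Variable n : nat.
Implicit Types (s t u v : 'S_n) (w p q : seq 'S_n).

Lemma abs_leE s t : abs_le s t = (tlen s + tlen (t * s^-1) == tlen t).
Proof. by []. Qed.

Lemma abs_le_tlen s t : abs_le s t -> tlen s <= tlen t.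
Proof. by rewrite abs_leE => /eqP <-; rewrite leq_addr. Qed.

Lemma abs_le_refl s : abs_le s s.
Proof. by rewrite abs_leE mulgV tlen1 addn0. Qed.

Lemma abs_le_eq s t : abs_le s t -> tlen t <= tlen s -> s = t.
Proof.
rewrite abs_leE => /eqP st ts; apply/esym/eqP; rewrite eq_mulgV1 -tlen_eq0.
by rewrite -leqn0 -(leq_add2l (tlen s)) st addn0.
Qed.

Lemma abs_le_trans s t u : abs_le s t -> abs_le t u -> abs_le s u.
Proof.
rewrite !abs_leE => /eqP st /eqP tu; rewrite eqn_leq; apply/andP; split.
  rewrite -tu -st -addnA leq_add2l addnC.
  have -> : u * s^-1 = (u * t^-1) * (t * s^-1) by rewrite mulgA mulgKV.
  exact: tlenM.
by rewrite -{1}[u](mulgKV s) addnC tlenM.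
Qed.

Definition reduced w := is_word w && (tlen (prodw w) == size w).

Lemma reduced_cat p q : reduced (p ++ q) -> reduced p /\ reduced q.
Proof.
rewrite /reduced all_cat prodw_cat size_cat -andbA => /and3P[wp wq /eqP pq].
have := tlenM (prodw q) (prodw p); have lp := tlen_min wp; have lq := tlen_min wq.
rewrite pq addnC => lpq; rewrite wp wq !eqn_leq lp lq /=; split.
  by rewrite -(leq_add2l (size q)) (leq_trans lpq) // leq_add2r.
by rewrite -(leq_add2r (size p)) (leq_trans lpq) // leq_add2l.
Qed.

Lemma abs_le_cat p q : reduced (p ++ q) -> abs_le (prodw p) (prodw (p ++ q)).
Proof.
move=> pq; have [/andP[_ /eqP lp] /andP[_ /eqP lq]] := reduced_cat pq.
move: pq => /andP[_ /eqP]; rewrite abs_leE prodw_cat mulgK lp lq => ->.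
by rewrite size_cat.
Qed.

Lemma abs_le_word s t : abs_le s t ->
  exists w, reduced w /\ t = prodw w * s /\ size w = tlen t - tlen s.
Proof.
rewrite abs_leE => /eqP st; have [w [ww pw sw]] := tlen_word (t * s^-1).
exists w; rewrite /reduced ww pw sw eqxx mulgKV; split=> //; split=> //.
by rewrite -st addnC addnK.
Qed.

Definition chain w : {set 'S_n} :=
  [set prodw (take (val j) w) | j : 'I_(size w).+1].

Lemma chainP w s :
  reflect (exists p q, w = p ++ q /\ s = prodw p) (s \in chain w).
Proof.
apply: (iffP imsetP) => [[j _ ->]|[p [q [-> ->]]]].
  by exists (take j w), (drop j w); rewrite cat_take_drop.
have ltp : size p < (size (p ++ q)).+1 by rewrite ltnS size_cat leq_addr.
by exists (Ordinal ltp); rewrite //= take_size_cat.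
Qed.

Lemma card_chain w : reduced w -> #|chain w| = (size w).+1.
Proof.
move=> rw; rewrite card_in_imset ?card_ord // => i j _ _ /(congr1 (@tlen n)).
have len (k : 'I_(size w).+1) : tlen (prodw (take k w)) = k.
  have := rw; rewrite -{1}(cat_take_drop k w) => /reduced_cat[/andP[_ /eqP ->] _].
  by rewrite size_takel // -ltnS.
by rewrite !len => /val_inj.
Qed.

Lemma cat_eq_prefix (p q p' q' : seq 'S_n) : p ++ q = p' ++ q' -> size p <= size p' ->
  exists r, p' = p ++ r.
Proof.
move=> e le; exists (drop (size p) p').
by rewrite -{1}(cat_take_drop (size p) p') -[take _ p'](takel_cat q') // -e take_size_cat.
Qed.

Lemma chain_comparable w s t : reduced w -> s \in chain w -> t \in chain w ->
  abs_le s t || abs_le t s.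
Proof.
move=> rw /chainP[p [q [wpq ->]]] /chainP[p' [q' [wpq' ->]]].
have e : p ++ q = p' ++ q' by rewrite -wpq.
have [rp _] : reduced p /\ reduced q by apply: reduced_cat; rewrite -wpq.
have [rp' _] : reduced p' /\ reduced q' by apply: reduced_cat; rewrite -wpq'.
have [le|/ltnW le] := leqP (size p) (size p').
  have [r pr] := cat_eq_prefix e le.
  by rewrite pr in rp' *; rewrite abs_le_cat.
have [r pr] := cat_eq_prefix (esym e) le.
by rewrite pr in rp *; rewrite abs_le_cat ?orbT.
Qed.

End AbsoluteOrder.

(** * The space moved by a permutation *)

Section MoveSpace.
Variable n : nat.
Implicit Types (s t u v : 'S_n) (w : seq 'S_n).
Local Open Scope ring_scope.
Import GRing.Theory.

(** The row space is spanned by the vectors [e_(s i) - e_i], and its orthogonal is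
the space fixed by [s]. *)
Definition move_mx s : 'M[rat]_n := perm_mx s - 1%:M.

Lemma row_move_mx s i : row i (move_mx s) = 'e_(s i) - 'e_i.
Proof. by rewrite linearB /= row1 perm_mxEsub row_rowsub row1. Qed.

Lemma move_mx1 : move_mx 1%g = 0.
Proof. by rewrite /move_mx perm_mx1 subrr. Qed.

Lemma move_mxM s t : (move_mx (s * t)%g <= move_mx s + move_mx t)%MS.
Proof.
have -> : move_mx (s * t)%g = move_mx s + perm_mx s *m move_mx t.
  by rewrite /move_mx perm_mxM mulmxBr mulmx1 [RHS]addrC addrA subrK.
by rewrite addmx_sub_adds ?submxMl.
Qed.

Lemma rank_move_mx_transposition t : t \in transpositions n -> (\rank (move_mx t) <= 1)%N.
Proof.
case/transpositionP=> x [y [_ ->]].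
have sub : (move_mx (tperm x y) <= ('e_x - 'e_y : 'rV_n))%MS.
  apply/row_subP => i; rewrite row_move_mx.
  by case: tpermP => [->|->|_ _]; rewrite ?subrr ?sub0mx // -opprB eqmx_opp.
exact: leq_trans (mxrankS sub) (rank_leq_row _).
Qed.

Lemma rank_move_mx_tlen s : (\rank (move_mx s) <= tlen s)%N.
Proof.
have [w [+ <- <-]] := tlen_word s; elim: w => [_|t w IH] /=.
  by rewrite move_mx1 mxrank0.
case/andP=> tT ww; apply: leq_trans (mxrankS (move_mxM _ _)) _.
apply: leq_trans (mxrank_adds_leqif _ _) _.
by rewrite -addn1 leq_add ?IH ?rank_move_mx_transposition.
Qed.

(** If [t = r s] with lengths adding up, then [V(t)] is contained in [V(s) + V(r)],
whose dimension is at most [tlen s + tlen r = tlen t].  When [V(t)] has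
dimension [tlen t] both bounds are attained. *)
Lemma abs_le_move_mx s t : \rank (move_mx t) = tlen t -> abs_le s t ->
  \rank (move_mx s) = tlen s /\ (move_mx s <= move_mx t)%MS.
Proof.
move=> rt; rewrite abs_leE => /eqP st; pose r := (t * s^-1)%g.
have sub : (move_mx t <= move_mx s + move_mx r)%MS.
  by rewrite -{1}[t](mulgKV s) -/r addsmxC move_mxM.
have le_sum : (\rank (move_mx s) + \rank (move_mx r) <= \rank (move_mx t))%N.
  by rewrite rt -st leq_add ?rank_move_mx_tlen.
have le_adds := mxrank_adds_leqif (move_mx s) (move_mx r).
have le_rank := leq_trans le_adds le_sum.
split.
  apply/eqP; rewrite eqn_leq rank_move_mx_tlen -(leq_add2r (tlen r)) st -rt.
  apply: leq_trans (mxrankS sub) (leq_trans le_adds _).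
  by rewrite leq_add2l rank_move_mx_tlen.
apply: submx_trans (addsmxSl _ (move_mx r)) _.
by rewrite -(geq_leqif (mxrank_leqif_sup sub)).
Qed.

End MoveSpace.

Section Cycle.
Variable m : nat.
Notation c := (long_cycle m.+1).
Local Open Scope ring_scope.

(** Modulo [V(c)] all basis vectors are equal, so [V(c)] together with one of them
spans the whole space. *)
Lemma rank_move_mx_long_cycle : (m <= \rank (move_mx c))%N.
Proof.
have e_sub (i : 'I_m.+1) : (('e_i : 'rV[rat]__) <= move_mx c + ('e_ord0 : 'rV_m.+1))%MS.
  case: i => i; elim: i => [|i IH] lti.
    by rewrite (_ : Ordinal lti = ord0) ?addsmxSr //; apply: val_inj.
  have -> : Ordinal lti = c (Ordinal (ltnW lti)).
    by apply: val_inj; rewrite permE /= modn_small.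
  rewrite -['e_(c _)](GRing.subrK 'e_(Ordinal (ltnW lti))) -row_move_mx.
  by rewrite addmx_sub ?IH // (submx_trans (row_sub _ _)) ?addsmxSl.
have : (1%:M <= move_mx c + ('e_ord0 : 'rV[rat]_m.+1))%MS.
  by apply/row_subP => i; rewrite row1 e_sub.
move=> /mxrankS; rewrite mxrank1 => le_n.
rewrite -ltnS; apply: leq_trans le_n (leq_trans (mxrank_adds_leqif _ _) _).
by rewrite -[X in (_ <= X)%N]addn1 leq_add2l rank_leq_row.
Qed.
End Cycle.

(** * Maximal chains of noncrossing partitions *)

Section MaximalChains.
Variable m : nat.
Notation n := m.+1.
Notation c := (long_cycle n).
Implicit Types (s t u v : 'S_n) (w p q : seq 'S_n) (C D : {set 'S_n}).

Lemma in_NC s : (s \in NC n) = abs_le s c.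
Proof. by rewrite inE. Qed.

(** The dimension of the moved space bounds the length from below, the number of
moved points bounds it from above. *)
Lemma tlen_long_cycle : tlen c = m.
Proof.
apply/eqP; rewrite eqn_leq (leq_trans (rank_move_mx_long_cycle m)) ?rank_move_mx_tlen //.
rewrite andbT -ltnS (leq_ltn_trans (tlen_support c)) // ltnS.
by case: #|_| (max_card [set x | c x != x]) => // k; rewrite card_ord.
Qed.

Lemma NC_chain_le C s t : NC_chain C -> s \in C -> t \in C ->
  tlen s <= tlen t -> abs_le s t.
Proof.
case/andP=> _ /forall_inP cC sC tC st.
have /forall_inP/(_ t tC)/orP[//|ts] := cC s sC.
by rewrite (abs_le_eq ts st) abs_le_refl.
Qed.

Lemma NC_chain_inj C : NC_chain C -> {in C &, injective (@tlen n)}.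
Proof.
move=> cC s t sC tC st; apply: abs_le_eq; last by rewrite st.
by apply: NC_chain_le cC sC tC _; rewrite st.
Qed.

Lemma NC_chain_tlen C s : NC_chain C -> s \in C -> tlen s <= m.
Proof.
case/andP=> /subsetP cC _ /cC; rewrite in_NC => /abs_le_tlen.
by rewrite tlen_long_cycle.
Qed.

Lemma NC_chain_card C : NC_chain C -> #|C| <= n.
Proof.
move=> cC; pose f s : 'I_n := inord (tlen s).
have f_inj : {in C &, injective f}.
  move=> s t sC tC /(congr1 val); rewrite /= !inordK ?ltnS ?(NC_chain_tlen cC) //.
  exact: NC_chain_inj cC s t sC tC.
by rewrite -(card_in_imset f_inj) (leq_trans (max_card _)) ?card_ord.
Qed.

(** Chains have at most one element of each length, so a chain of [n] elements is full. *)
Lemma maxset_card C : NC_chain C -> #|C| = n -> maxset (@NC_chain n) C.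
Proof.
move=> cC Cn; apply/maxsetP; split=> // D cD sCD; apply/esym/eqP.
by rewrite eqEcard sCD Cn NC_chain_card.
Qed.

Lemma chain_maxset w : reduced w -> prodw w = c -> maxset (@NC_chain n) (chain w).
Proof.
move=> rw pw; have sw : size w = m.
  by case/andP: rw => _ /eqP <-; rewrite pw tlen_long_cycle.
apply: maxset_card; last by rewrite card_chain // sw.
apply/andP; split.
  apply/subsetP => s /chainP[p [q [wpq ->]]]; rewrite in_NC -pw wpq.
  by rewrite abs_le_cat // -wpq.
by apply/forall_inP => s sC; apply/forall_inP => t tC; apply: chain_comparable rw sC tC.
Qed.

(** The chain extended by [v] is still a chain, so by maximality it already contains [v]. *)
Lemma maxset_mem C v : maxset (@NC_chain n) C -> abs_le v c ->
  {in C, forall s, abs_le s v || abs_le v s} -> v \in C.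
Proof.
move=> /maxsetP[/andP[/subsetP sC /forall_inP cC] maxC] vc vC.
suff cvC : NC_chain (v |: C) by rewrite -(maxC _ cvC (subsetUr _ _)) setU11.
apply/andP; split.
  by apply/subsetP => s /setU1P[->|/sC //]; rewrite in_NC.
apply/forall_inP => s /setU1P[->|sC']; apply/forall_inP => t /setU1P[->|tC'].
- by rewrite abs_le_refl.
- by rewrite orbC vC.
- exact: vC.
- by have /forall_inP := cC s sC'; apply.
Qed.

(** A word is grown one letter at a time inside the chain.  Given a prefix with
product [s], let [t] be the next element of the chain: the first letter of a
reduced word from [s] to [t] gives an element between [s] and [t], which is
comparable to the whole chain and hence belongs to it. *)
Lemma maxset_word C : maxset (@NC_chain n) C ->
  exists w, [/\ reduced w, prodw w = c & C = chain w].
Proof.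
move=> mC; have cC : NC_chain C by case/maxsetP: mC.
have leC s : s \in C -> abs_le s c.
  by case/andP: cC => /subsetP sC _ /sC; rewrite in_NC.
have cinC : c \in C.
  by apply: maxset_mem mC (abs_le_refl _) _ => s /leC ->.
have id_le s : abs_le 1 s by rewrite abs_leE tlen1 invg1 mulg1.
have extend j : j <= m ->
    exists w, [/\ reduced w, size w = j & chain w \subset C].
  elim: j => [_|j IH ltjm].
    exists [::]; split=> //; first by rewrite /reduced /= tlen1.
    apply/subsetP => s /chainP[[|? ?] [q [//= _ ->]]].
    by apply: maxset_mem mC (id_le _) _ => t _; rewrite id_le orbT.
  have [w [rw sw wC]] := IH (ltnW ltjm).
  have sinC : prodw w \in C.
    by apply: (subsetP wC); apply/chainP; exists w, [::]; rewrite cats0.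
  have lenw : tlen (prodw w) = j by case/andP: rw => _ /eqP ->.
  have cP : (c \in C) && (j < tlen c) by rewrite cinC tlen_long_cycle.
  (* [t] is the successor of the partial product [prodw w] in the chain. *)
  case: (arg_minnP (P := fun t => (t \in C) && (j < tlen t)) (@tlen n) cP) => t.
  case/andP=> tC ltjt mint.
  have st : abs_le (prodw w) t.
    by apply: NC_chain_le cC sinC tC _; rewrite lenw ltnW.
  have [[|a r] [rr [te sr]]] := abs_le_word st.
    by move/eqP: sr; rewrite lenw eq_sym subn_eq0 leqNgt ltjt.
  have rt : reduced (w ++ a :: r).
    rewrite /reduced all_cat prodw_cat -te size_cat sr lenw sw subnKC 1?ltnW // eqxx.
    by case/andP: rw => -> _; case/andP: rr => ->.
  rewrite -prodw_cat in te; rewrite -cat_rcons in rt te.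
  have [rv _] := reduced_cat rt.
  have sv : abs_le (prodw w) (prodw (rcons w a)).
    by rewrite -cats1 in rv *; apply: abs_le_cat.
  have vt : abs_le (prodw (rcons w a)) t by rewrite te abs_le_cat.
  have vC : prodw (rcons w a) \in C.
    apply: maxset_mem mC (abs_le_trans vt (leC _ tC)) _ => d dC.
    have [dj|jd] := leqP (tlen d) j.
      apply/orP; left; apply: abs_le_trans sv.
      by apply: NC_chain_le cC dC sinC _; rewrite lenw.
    apply/orP; right; apply: abs_le_trans vt _.
    by apply: (NC_chain_le cC tC dC); apply: mint; rewrite dC.
  exists (rcons w a); split=> //; first by rewrite size_rcons sw.
  apply/subsetP => s /chainP[p [q [+ ->]]].
  case: (lastP q) => [|q' b]; first by rewrite cats0 => <-.
  rewrite -rcons_cat => /rcons_inj[wE _]; apply: (subsetP wC).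
  by apply/chainP; exists p, q'.
have [w [rw sw wC]] := extend m (leqnn _).
have eqC : C = chain w.
  by apply/esym/eqP; rewrite eqEcard wC card_chain // sw NC_chain_card.
exists w; split=> //; apply: abs_le_eq.
  by apply: leC; rewrite eqC; apply/chainP; exists w, [::]; rewrite cats0.
by case/andP: rw => _ /eqP ->; rewrite sw tlen_long_cycle.
Qed.

End MaximalChains.

(** * Jumps of a flag of subspaces *)

Section Flags.
Variables (n m : nat) (U : nat -> 'M[rat]_n).
Implicit Types A B : 'M[rat]_n.
Local Open Scope ring_scope.

(** Only the part of the step from [U i] to [U i.+1] that survives modulo [A]
counts: when every step has dimension at most one, these are the indices at
which the dimension of [U i + A] grows. *)
Definition jumps A : {set 'I_m} := [set i : 'I_m | ~~ (U i.+1 <= U i + A)%MS].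

Lemma jumpsS A B : (A <= B)%MS -> jumps B \subset jumps A.
Proof.
move=> AB; apply/subsetP => i; rewrite !inE; apply: contra => /submx_trans; apply.
exact: addsmxS.
Qed.

Hypothesis U0 : U 0%N = 0.
Hypothesis US : forall i, (i < m)%N -> (U i <= U i.+1)%MS.
Hypothesis U_line : forall i, (i < m)%N ->
  exists2 L : 'M[rat]_n, (\rank L <= 1)%N & (U i.+1 <= U i + L)%MS.

Lemma flagS i j : (i <= j <= m)%N -> (U i <= U j)%MS.
Proof.
case/andP=> /subnK <-; elim: (j - i)%N => [|k IH] //= lt.
by rewrite addSn in lt *; apply: submx_trans (IH (ltnW lt)) (US lt).
Qed.

(** The dimension of [U i + A] grows from that of [A] to that of [U m], by one at
each jump. *)
Lemma card_jumps A : (A <= U m)%MS -> (#|jumps A| + \rank A = \rank (U m))%N.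
Proof.
move=> AU.
have -> : \rank (U m) = \rank (U m + A) by rewrite (addsmx_idPl AU).
suff sum k : (k <= m)%N ->
    \rank (U k + A) = (\sum_(i < m | (i < k)%N) (i \in jumps A) + \rank A)%N.
  rewrite sum // -sum1_card big_mkcond /=; congr (_ + _)%N.
  rewrite [RHS](eq_bigl predT) => [|i]; last by rewrite ltn_ord.
  by apply: eq_bigr => i _; case: (i \in _).
elim: k => [_|k IH ltk].
  by rewrite big_pred0 // U0 add0n adds0mx.
rewrite (bigD1 (Ordinal ltk)) //= (eq_bigl (fun i : 'I_m => (i < k)%N)); last first.
  by move=> i; rewrite ltnS leq_eqVlt -val_eqE /=; case: ltngtP.
rewrite -addnA -IH ?(ltnW ltk) // inE /=.
have sub : (U k + A <= U k.+1 + A)%MS by rewrite addsmxS ?US.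
case: (boolP (U k.+1 <= _)%MS) => inU /=.
  by apply/eqP; rewrite add0n eq_sym (mxrank_leqif_sup sub) addsmx_sub inU addsmxSr.
apply/eqP; rewrite add1n eqn_leq; apply/andP; split.
  have [L L1 UL] := U_line ltk.
  have: (U k.+1 + A <= (U k + A) + L)%MS.
    rewrite addsmx_sub (submx_trans UL) ?addsmxS ?addsmxSl //=.
    by rewrite (submx_trans (addsmxSr (U k) A)) ?addsmxSl.
  move=> /mxrankS/leq_trans; apply.
  by rewrite -addn1 (leq_trans (mxrank_adds_leqif _ _)) // leq_add2l.
by rewrite (ltn_leqif (mxrank_leqif_sup sub)) addsmx_sub negb_and inU.
Qed.
End Flags.

(** * Inversions relative to a reference chain *)

Lemma card_ltn_ord m j : j <= m -> #|[set i : 'I_m | i < j]| = j.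
Proof.
move=> jm; rewrite -sum1_card (eq_bigl (fun i : 'I_m => i < j)) => [|i].
  by rewrite -(big_ord_widen m (fun=> 1%N) jm) sum1_card card_ord.
by rewrite inE.
Qed.

Lemma card_ltn_pairs m :
  #|[set p : 'I_m * 'I_m | p.1 < p.2]| = 'C(m, 2).
Proof.
rewrite -sum1_card (eq_bigl (fun p : 'I_m * 'I_m => p.1 < p.2)); last first.
  by move=> p; rewrite inE.
pose lt1 (i j : 'I_m) : nat := if i < j then 1%N else 0%N.
rewrite big_mkcond -(pair_bigA _ lt1) /=.
rewrite exchange_big -bin2_sum big_mkord; apply: eq_bigr => j _.
by rewrite -big_mkcond -(big_ord_widen m (fun=> 1%N) (ltnW (ltn_ord j)))
  sum1_card card_ord.
Qed.

Section Inversions.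
Variable m : nat.
Notation n := m.+1.
Notation c := (long_cycle n).
Implicit Types (s t u v : 'S_n) (p q : seq 'S_n) (C D : {set 'S_n}).

Lemma rank_move_mx_NC s : abs_le s c -> \rank (move_mx s) = tlen s /\ (move_mx s <= move_mx c)%MS.
Proof.
apply: abs_le_move_mx; apply/eqP.
by rewrite eqn_leq rank_move_mx_tlen tlen_long_cycle rank_move_mx_long_cycle.
Qed.

Variable w : seq 'S_n.
Hypotheses (rw : reduced w) (pw : prodw w = c).

Definition word_flag i : 'M[rat]_n := move_mx (prodw (take i w)).

Definition jump_set s : {set 'I_m} := jumps m word_flag (move_mx s).

Lemma size_word : size w = m.
Proof. by case/andP: rw => _ /eqP <-; rewrite pw tlen_long_cycle. Qed.

Lemma prefix_le i : abs_le (prodw (take i w)) c.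
Proof. by rewrite -pw -{2}(cat_take_drop i w) abs_le_cat ?cat_take_drop. Qed.

Lemma prefix_tlen i : i <= m -> tlen (prodw (take i w)) = i.
Proof.
move=> im; have := rw; rewrite -{1}(cat_take_drop i w) => /reduced_cat[].
by case/andP=> _ /eqP -> _; rewrite size_takel // size_word.
Qed.

Lemma word_flag0 : word_flag 0 = 0%R.
Proof. by rewrite /word_flag take0 move_mx1. Qed.

Lemma word_flag_full : word_flag m = move_mx c.
Proof. by rewrite /word_flag take_oversize ?pw ?size_word. Qed.

Lemma word_flag_sub i : i < m -> (word_flag i <= word_flag i.+1)%MS.
Proof.
move=> im; apply: (abs_le_move_mx _ _).2.
  exact: (rank_move_mx_NC (prefix_le _)).1.
rewrite (take_nth 1) ?size_word // -cats1; apply: abs_le_cat.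
rewrite cats1 -take_nth ?size_word //.
by have := rw; rewrite -{1}(cat_take_drop i.+1 w) => /reduced_cat[].
Qed.

Lemma word_flag_line i : i < m ->
  exists2 L : 'M[rat]_n, \rank L <= 1 & (word_flag i.+1 <= word_flag i + L)%MS.
Proof.
move=> im; exists (move_mx (nth 1 w i)).
  apply: rank_move_mx_transposition; case/andP: rw => /allP ww _.
  by apply: ww; rewrite mem_nth ?size_word.
rewrite /word_flag (take_nth 1) ?size_word // -cats1 prodw_cat addsmxC /=.
by rewrite /pmul mul1g move_mxM.
Qed.

Lemma card_jump_set s : abs_le s c -> #|jump_set s| = m - tlen s.
Proof.
case/rank_move_mx_NC=> <-; rewrite -word_flag_full => sub.
have := card_jumps word_flag0 word_flag_sub word_flag_line sub.
have -> : \rank (word_flag m) = m.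
  by rewrite word_flag_full (rank_move_mx_NC (abs_le_refl _)).1 tlen_long_cycle.
by rewrite -/(jump_set s); lia.
Qed.

Lemma jump_setS s t : abs_le s t -> abs_le t c -> jump_set t \subset jump_set s.
Proof.
by move=> st /rank_move_mx_NC[rt _]; apply: jumpsS; exact: (abs_le_move_mx rt st).2.
Qed.

(** Along a maximal chain the jump sets lose their elements one by one; the pair
[a < b] is inverted when [b] is lost before [a], that is when some element of
the chain still has the jump [a] but no longer [b]. *)
Definition inversions C : {set 'I_m * 'I_m} :=
  [set p : 'I_m * 'I_m | (p.1 < p.2) &&
    [exists s in C, (p.1 \in jump_set s) && (p.2 \notin jump_set s)]].

(** A pair inverted by [C] but not by [D] must be witnessed by the only element [v]
of [C] outside [D], and neither by the element [s] of [C] below [v] nor by the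
element [u] above it.  So its two entries are the jump lost between [v] and [u]
and the jump lost between [s] and [v], which determines it. *)
Lemma inversions_lipschitz C D :
  maxset (@NC_chain n) C -> maxset (@NC_chain n) D -> #|C :\: D| <= 1 ->
  #|inversions C| <= #|inversions D|.+1.
Proof.
move=> mC mD CD; rewrite -(cardsID (inversions D)) -[_.+1]addn1.
apply: leq_add; first by rewrite subset_leq_card ?subsetIr.
have [w' [rw' pw' Cw']] := maxset_word mC.
have step p a q : w' = p ++ a :: q ->
    jump_set (prodw (rcons p a)) \subset jump_set (prodw p)
    /\ #|jump_set (prodw p) :\: jump_set (prodw (rcons p a))| <= 1.
  move=> wE; have := rw'; rewrite wE -cat_rcons => rpaq.
  have [rpa _] := reduced_cat rpaq.
  have le_c : abs_le (prodw (rcons p a)) c.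
    by rewrite -pw' wE -cat_rcons abs_le_cat.
  have le_pa : abs_le (prodw p) (prodw (rcons p a)).
    by rewrite -cats1 in rpa *; apply: abs_le_cat.
  have sub := jump_setS le_pa le_c; split=> //.
  rewrite cardsDS // !card_jump_set //; last exact: abs_le_trans le_pa le_c.
  have [rp _] : reduced p /\ reduced [:: a] by apply: reduced_cat; rewrite cats1.
  case/andP: rp => _ /eqP ->; case/andP: rpa => _ /eqP ->.
  by rewrite size_rcons; lia.
(* [D] does not invert [x], so no element of [D] can be a witness. *)
have witness x : x \in inversions C :\: inversions D ->
    exists2 v, v \in C :\: D & (x.1 \in jump_set v) && (x.2 \notin jump_set v).
  rewrite !inE negb_and => /andP[+ /andP[x12 /exists_inP[v vC xv]]].
  rewrite x12 /= => /exists_inPn xD; exists v => //.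
  by rewrite inE vC andbT; apply: contraL xv => /xD.
have end_D s : abs_le s c -> {in D, forall t, abs_le s t || abs_le t s} -> s \in D.
  by move=> sc sD; apply: maxset_mem mD sc _ => t /sD; rewrite orbC.
have D1 : 1 \in D.
  by apply: end_D => [|t _]; rewrite abs_leE tlen1 invg1 mulg1 ?eqxx.
have Dc : c \in D.
  apply: end_D (abs_le_refl _) _ => t tD; apply/orP; right.
  by case/maxsetP: mD => /andP[/subsetP sD _] _; rewrite -in_NC sD.
apply/card_le1_eqP => x y xin yin.
have [v vCD xv] := witness x xin.
have [p [a [b [q [wE vE]]]]] : exists p a b q,
    w' = p ++ [:: a, b & q] /\ v = prodw (rcons p a).
  move: vCD; rewrite inE Cw' => /andP[vD /chainP[r [[|b q] [wE vE]]]].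
    by rewrite cats0 in wE; rewrite vE -wE pw' Dc in vD.
  case: (lastP r) => [|p a] in wE vE; first by rewrite vE D1 in vD.
  by exists p, a, b, q; rewrite -cat_rcons.
have [sub1 card1] := step p a (b :: q) wE.
have [sub2 card2] : _ /\ _ := step (rcons p a) b q (etrans wE (esym (cat_rcons _ _ _))).
rewrite -vE in sub1 card1 sub2 card2.
set s := prodw p in sub1 card1; set u := prodw _ in sub2 card2.
have lenw r r' : w' = r ++ r' -> tlen (prodw r) = size r.
  by move=> e; have := rw'; rewrite e => /reduced_cat[/andP[_ /eqP]].
have lenv : tlen v = (size p).+1.
  by rewrite vE (lenw _ (b :: q)) ?size_rcons ?cat_rcons.
have inD t : t \in C -> tlen t != tlen v -> t \in D.
  move=> tC; apply: contraR => tD; apply/eqP; congr tlen.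
  by apply: (card_le1_eqP CD); rewrite // inE tC tD.
have sD : s \in D.
  apply: inD; first by rewrite Cw'; apply/chainP; exists p, [:: a, b & q].
  by rewrite lenv (lenw _ [:: a, b & q]) // neq_ltn ltnSn.
have uD : u \in D.
  have wE' : w' = rcons (rcons p a) b ++ q by rewrite !cat_rcons.
  apply: inD; first by rewrite Cw'; apply/chainP; exists (rcons (rcons p a) b), q.
  by rewrite lenv (lenw _ q) // !size_rcons neq_ltn ltnSn orbT.
(* The larger entry is lost on reaching [v], the smaller one on leaving it. *)
have key z : z \in inversions C :\: inversions D ->
    z.1 \in jump_set v :\: jump_set u /\ z.2 \in jump_set s :\: jump_set v.
  move=> zin; have [v' vCD' zv] := witness z zin.
  rewrite (card_le1_eqP CD _ _ vCD vCD') in zv; case/andP: zv => z1 z2.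
  have z12 : z.1 < z.2 by move: zin; rewrite !inE => /and3P[].
  have notD t : t \in D -> z.1 \in jump_set t -> z.2 \in jump_set t.
    move=> tD z1t; apply/negPn/negP => z2t; move: zin.
    rewrite !inE z12 negb_and /= => /andP[/exists_inPn/(_ t tD)].
    by rewrite z1t z2t.
  rewrite !in_setD z1 z2 !andbT; split.
    by apply: contra z2 => z1u; rewrite (subsetP sub2) // notD.
  by rewrite notD // (subsetP sub1).
have [x1 x2] := key x xin; have [y1 y2] := key y yin.
rewrite [x]surjective_pairing [y]surjective_pairing.
by rewrite (card_le1_eqP card2 _ _ y1 x1) (card_le1_eqP card1 _ _ y2 x2).
Qed.

(** The steps of the flag up to [x_j] are contained in [V(x_j)], so the jumps of
[x_j] are exactly the last ones and the jumps are lost in increasing order. *)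
Lemma inversions_chain : inversions (chain w) = set0.
Proof.
apply/setP => -[a b]; rewrite !inE /=; apply/negP => /andP[ab].
case/exists_inP=> s /imsetP[[j ltj] _ ->] /=; rewrite ltnS size_word in ltj.
set x := prodw _; have xc : abs_le x c := prefix_le j.
pose late := [set i : 'I_m | j <= i].
have sub : jump_set x \subset late.
  apply/subsetP => i; rewrite !inE; apply: contraR; rewrite -ltnNge => ij.
  apply: submx_trans (addsmxSr _ _).
  by apply: (flagS word_flag_sub); rewrite ij ltj.
have late_card : #|late| <= #|jump_set x|.
  rewrite card_jump_set // prefix_tlen //.
  have -> : late = ~: [set i : 'I_m | i < j] by apply/setP => i; rewrite !inE -leqNgt.
  by rewrite cardsCs setCK card_ord card_ltn_ord.
have -> : jump_set x = late by apply/eqP; rewrite eqEcard sub.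
by rewrite !inE => /andP[ja]; rewrite (leq_trans ja (ltnW ab)).
Qed.

End Inversions.

(** * The Kreweras complement *)

Section Kreweras.
Variable m : nat.
Notation n := m.+1.
Notation c := (long_cycle n).
Implicit Types (s t u v : 'S_n) (w : seq 'S_n) (C D : {set 'S_n}).

Lemma kreweras_tlen s : abs_le s c -> tlen (c * s^-1) = m - tlen s.
Proof. by rewrite abs_leE tlen_long_cycle => /eqP; lia. Qed.

(** The quotient of the two complements is conjugate to the quotient of [t] by [s]. *)
Lemma kreweras_anti s t : abs_le s t -> abs_le t c ->
  abs_le (c * t^-1) (c * s^-1).
Proof.
move=> st tc; have sc := abs_le_trans st tc.
have quotient : (c * s^-1) * (c * t^-1)^-1 = (t * s^-1) ^ (s * c^-1).
  by rewrite conjgE !invMg !invgK !mulgA mulgKV.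
rewrite abs_leE quotient tlenJ !kreweras_tlen //.
have := abs_le_tlen tc; rewrite tlen_long_cycle => tm.
by move: st; rewrite abs_leE => /eqP st; apply/eqP; lia.
Qed.

(** In right-to-left composition these are the elements [s^-1 c]. *)
Definition kreweras C : {set 'S_n} := [set c * s^-1 | s in C].

Lemma kreweras_maxset C : maxset (@NC_chain n) C -> maxset (@NC_chain n) (kreweras C).
Proof.
move=> mC; have [w [rw pw Cw]] := maxset_word mC.
have /andP[/subsetP sC cC] : NC_chain C by case/maxsetP: mC.
have leC s : s \in C -> abs_le s c by move/sC; rewrite in_NC.
apply: maxset_card; last first.
  rewrite card_imset => [|s t]; last by move/mulgI/invg_inj.
  by rewrite Cw card_chain // (size_word rw pw).
apply/andP; split.
  apply/subsetP => _ /imsetP[s sinC ->]; rewrite in_NC.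
  rewrite -{2}[c]mulg1 -invg1 kreweras_anti ?leC //.
  by rewrite abs_leE tlen1 invg1 mulg1.
apply/forall_inP => _ /imsetP[s sinC ->]; apply/forall_inP => _ /imsetP[t tinC ->].
have /forall_inP/(_ t tinC) := (forall_inP cC) s sinC.
by case/orP=> le; apply/orP; [right|left]; rewrite kreweras_anti ?leC.
Qed.

(** Since [V(x_b)] and [V(x_b^-1 c)] span [V(c)], the complement of [x_b] has no jump
from [b] on; by cardinality its jumps are exactly the first [b] ones.  It is
therefore a witness for all pairs whose larger entry is [b]. *)
Lemma inversions_kreweras w (rw : reduced w) (pw : prodw w = c) :
  inversions w (kreweras (chain w)) = [set p : 'I_m * 'I_m | p.1 < p.2].
Proof.
apply/setP => -[a b]; rewrite !inE /=; case: ltnP => //= ab.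
set x := prodw (take b w); have xc : abs_le x c := prefix_le rw pw b.
have kxc : abs_le (c * x^-1) c.
  by rewrite -{2}[c]mulg1 -invg1 kreweras_anti // abs_leE tlen1 invg1 mulg1.
apply/exists_inP; exists (c * x^-1).
  by apply: imset_f; apply/chainP; exists (take b w), (drop b w); rewrite cat_take_drop.
pose early := [set i : 'I_m | i < b].
have sub : jump_set w (c * x^-1) \subset early.
  apply/subsetP => i; rewrite !inE; apply: contraR; rewrite -leqNgt => bi.
  have [flag1 flag2] := (word_flag_sub rw pw, word_flag_full rw pw).
  apply: submx_trans (flagS (j := m) flag1 _) _; first by rewrite ltn_ord leqnn.
  rewrite flag2 -{1}[c](mulgKV x) (submx_trans (move_mxM _ _)) // addsmxC.
  by rewrite addsmxS // (flagS flag1) // bi ltnW.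
have bm : b <= m := ltnW (ltn_ord b).
have early_card : #|early| = b by apply: card_ltn_ord.
have -> : jump_set w (c * x^-1) = early.
  apply/eqP; rewrite eqEcard sub early_card (card_jump_set rw pw) //.
  by rewrite kreweras_tlen // (prefix_tlen rw pw) // subKn ?leqnn.
by rewrite !inE ab ltnn.
Qed.

End Kreweras.

(** * Distances and radius *)

Section Graph.
Variables (V : finType) (adj : rel V).
Implicit Types (u v : V) (k : nat).

Lemma has_walkP u v k :
  reflect (exists p, [/\ path adj u p, last u p = v & size p = k]) (has_walk adj u v k).
Proof.
apply: (iffP existsP) => [[p /andP[up /eqP lp]]|[p [up lp sp]]].
  by exists p; rewrite size_tuple.
by move/eqP: sp => sp; exists (Tuple sp); rewrite /= up lp eqxx.
Qed.

Lemma gdist_path u p : path adj u p -> gdist adj u (last u p) <= size p.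
Proof.
move=> up; rewrite /gdist leqNgt; apply/negP => lt.
have ltV : size p < #|V| by apply: leq_trans lt _; rewrite -[X in _ <= X](size_iota 0) find_size.
have := before_find 0 lt; rewrite nth_iota // add0n => /has_walkP.
by apply; exists p.
Qed.

(** Removing the loops of a path leaves fewer than [#|V|] edges. *)
Lemma gdist_lt u p : path adj u p -> gdist adj u (last u p) < #|V|.
Proof.
case/shortenP=> q uq uniq_q _; apply: leq_ltn_trans (gdist_path uq) _.
by move/card_uniqP: uniq_q => /= <-; apply: max_card.
Qed.

Lemma gdist_walk u v : gdist adj u v < #|V| ->
  exists p, [/\ path adj u p, last u p = v & size p = gdist adj u v].
Proof.
move=> lt; apply/has_walkP.
rewrite -[X in has_walk adj u v X]add0n -(nth_iota 0 0 lt); apply: nth_find.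
by rewrite has_find size_iota.
Qed.

(** Every [gdist] is at most [#|V|], so by the second hypothesis [k] is also at most
the neutral element of the minimum defining the radius. *)
Lemma radiusE k u0 : (forall v, gdist adj u0 v <= k) ->
  (forall u, exists v, k <= gdist adj u v) -> radius adj = k.
Proof.
move=> le_k ge_k; apply/eqP; rewrite eqn_leq; apply/andP; split.
  have le_big (F : V -> nat) r :
      u0 \in r -> \big[minn/#|V|]_(v <- r) F v <= F u0.
    elim: r => // u r IH; rewrite in_cons big_cons geq_min.
    by case/orP=> [/eqP <-|/IH ->]; rewrite ?leqnn ?orbT.
  apply: leq_trans (le_big _ _ (mem_index_enum u0)) _.
  by apply/bigmax_leqP.
rewrite /radius; elim/big_ind: _ => [|a b ka kb|u _].
- have [v kv] := ge_k u0; apply: leq_trans kv _.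
  by rewrite -[X in _ <= X](size_iota 0) find_size.
- by rewrite leq_min ka.
- by have [v kv] := ge_k u; apply: leq_trans kv (leq_bigmax _).
Qed.

End Graph.

(** * The Hurwitz graph *)

Section HurwitzGraph.
Variable m : nat.
Notation n := m.+1.
Notation c := (long_cycle n).
Implicit Types (w : seq 'S_n).

Lemma hurwitz_adjC : symmetric (@hurwitz_adj n).
Proof. by move=> u v; rewrite /hurwitz_adj andbC. Qed.

Lemma card_maxchain (u : NC_maxchain n) : #|val u| = n.
Proof.
by have [w [rw pw ->]] := maxset_word (valP u); rewrite card_chain // (size_word rw pw).
Qed.

(** Two maximal chains have the same cardinality, so their two differences do as
well. *)
Lemma hurwitz_adj_card (u v : NC_maxchain n) : #|val u :\: val v| <= 1 ->
  u = v \/ hurwitz_adj u v.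
Proof.
have cuv : #|val u :\: val v| = #|val v :\: val u|.
  apply/eqP; rewrite -(eqn_add2l #|val u :&: val v|) cardsID.
  by rewrite setIC cardsID !card_maxchain.
rewrite leq_eqVlt ltnS leqn0 => /orP[uv|/eqP uv].
  by right; rewrite /hurwitz_adj -cuv uv.
left; apply/val_inj/eqP; rewrite eqEcard !card_maxchain leqnn andbT.
by rewrite -setD_eq0 -cards_eq0 uv.
Qed.

Lemma chain_move p q (a b a' b' : 'S_n) : pmul a b = pmul a' b' ->
  #|chain (p ++ [:: a, b & q]) :\: chain (p ++ [:: a', b' & q])| <= 1.
Proof.
move=> ab; rewrite -(cards1 (prodw (rcons p a))) subset_leq_card //.
apply/subsetP => s; rewrite !inE => /andP[sN /chainP[r [r' [e sr]]]].
rewrite sr in sN *; have [le|gt] := leqP (size r) (size p).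
  have [z pz] := cat_eq_prefix (esym e) le; case/negP: sN.
  by apply/chainP; exists r, (z ++ [:: a', b' & q]); rewrite pz -catA.
have [z rz] := cat_eq_prefix e (ltnW gt); subst r.
move: e; rewrite -catA => /eqP; rewrite eqseq_cat // eqxx /= => /eqP.
case: z gt sN {sr} => [|a1 [|b1 z]].
- by rewrite cats0 ltnn.
- by move=> _ _ [<- _]; rewrite cats1.
move=> _ sN [aE bE qE]; subst a1 b1; case/negP: sN; apply/chainP.
exists (p ++ [:: a', b' & z]), r'; rewrite qE -catA; split=> //.
by rewrite !prodw_cat /= -[pmul a _]mulgA -[pmul a' _]mulgA; congr (_ * _ * _).
Qed.

Lemma hurwitz_walk_path k w w' (u v : NC_maxchain n) : hurwitz_walk k w w' ->
  reduced w -> prodw w = c -> val u = chain w -> val v = chain w' ->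
  exists p, [/\ path (@hurwitz_adj n) u p, last u p = v & size p <= k].
Proof.
move=> walk; elim: walk u => [{}k {}w|{}k p q a b a' b' {}w' ww ab walk IH] u rw pw uw vw.
  by exists [::]; split=> //; apply: val_inj; rewrite uw vw.
set w1 := p ++ _ in rw pw uw; set w2 := p ++ [:: a', b' & q] in walk IH.
have [ww2 pw2 sw2] := hurwitz_walk_invariant
  (hurwitz_walk_step ww ab (hurwitz_walk_refl 0 w2)).
rewrite -/w1 in ww2 pw2 sw2; have := rw; rewrite /reduced pw2 sw2 => /andP[/ww2 {}ww2 rw2].
have rw2' : reduced w2 by rewrite /reduced ww2.
have mw2 : maxset (@NC_chain n) (chain w2) by apply: chain_maxset; rewrite -?pw2.
pose u2 : NC_maxchain n := exist _ (chain w2) mw2.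
have [r [ur rv sr]] := IH u2 rw2' (etrans (esym pw2) pw) erefl vw.
have [|uu2|uu2] := @hurwitz_adj_card u u2; first by rewrite uw chain_move.
  by exists r; rewrite uu2; split=> //; apply: leqW.
by exists (u2 :: r); rewrite /= uu2.
Qed.

Lemma inversions_path w (rw : reduced w) (pw : prodw w = c) (u : NC_maxchain n) p :
  path (@hurwitz_adj n) u p ->
  #|inversions w (val (last u p))| <= #|inversions w (val u)| + size p.
Proof.
elim: p u => [|v p IH] u /=; first by rewrite addn0.
case/andP=> /andP[_ /eqP vu] /IH le; apply: leq_trans le _.
rewrite -addSnnS leq_add2r (inversions_lipschitz rw pw (valP v) (valP u)) //.
by rewrite vu.
Qed.

End HurwitzGraph.

Theorem theorem10p3 (n : nat) (hn : 1 <= n) :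
  radius (@hurwitz_adj n) = 'C(n.-1, 2).
Proof.
case: n hn => // m _; set c := long_cycle m.+1.
have maxchain_word (u : NC_maxchain m.+1) :
    exists w, [/\ reduced w, prodw w = c & val u = chain w].
  exact: maxset_word (valP u).
have [w0 near] := hurwitz_walk_common_end (tlen_long_cycle m).
have near0 w : reduced w -> prodw w = c -> hurwitz_walk 'C(m, 2) w w0.
  by move=> rw pw; apply: near => //; [case/andP: rw | apply: size_word rw pw].
have [u0 u0E] : exists u0 : NC_maxchain m.+1, val u0 = chain w0.
  have [w [ww pw sw]] := tlen_word c.
  have rw : reduced w by rewrite /reduced ww pw sw eqxx.
  have [/(_ ww) ww0 pw0 sw0] := hurwitz_walk_invariant (near0 w rw pw).
  have m0 : maxset (@NC_chain m.+1) (chain w0).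
    by apply: chain_maxset; rewrite -?pw0 // /reduced ww0 -pw0 -sw0 pw sw eqxx.
  by exists (exist _ (chain w0) m0).
have toward u : exists p, [/\ path (@hurwitz_adj m.+1) u p, last u p = u0
                           & size p <= 'C(m, 2)].
  have [w [rw pw uw]] := maxchain_word u.
  exact: hurwitz_walk_path (near0 w rw pw) rw pw uw u0E.
have away u : exists p, [/\ path (@hurwitz_adj m.+1) u0 p, last u0 p = u
                         & size p <= 'C(m, 2)].
  have [p [up lp sp]] := toward u; exists (rev (belast u p)).
  rewrite size_rev size_belast -lp rev_path; split=> //.
    by rewrite (eq_path (e' := @hurwitz_adj m.+1)) // => x y; rewrite hurwitz_adjC.
  by case: p {up lp sp} => //= x p; rewrite rev_cons last_rcons.
apply: (@radiusE _ _ _ u0) => [v|u].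
  by have [p [up <- sp]] := away v; apply: leq_trans (gdist_path up) sp.
have [w [rw pw uw]] := maxchain_word u.
pose v : NC_maxchain m.+1 := exist _ (kreweras (val u)) (kreweras_maxset (valP u)).
exists v.
have [p [up lp _]] := toward u; have [q [uq lq _]] := away v.
have [|r [ur rv <-]] := @gdist_walk _ (@hurwitz_adj m.+1) u v.
  rewrite -[v]lq -lp -last_cat; apply: gdist_lt.
  by rewrite cat_path up lp.
have := inversions_path rw pw ur; rewrite rv /= uw.
by rewrite inversions_kreweras // inversions_chain // cards0 add0n card_ltn_pairs.
Qed.
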